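(* Let $\mathcal{M}=(\mathbb{R}^2,\nabla)$ be a Type $\mathcal{A}$ model. Then there exists a linear function $g(x^1,x^2)=a_1x^1+a_2x^2$ (with $a_1,a_2\in\mathbb{R}$) which provides a strong projective equivalence from $\mathcal{M}$ to a flat Type $\mathcal{A}$ model.
   Context: An affine surface is a pair $(M,\nabla)$ where $M$ is a smooth surface and $\nabla$ is a torsion free connection on $TM$. In local coordinates $\nabla_{\partial_{x^i}}\partial_{x^j}=\Gamma_{ij}{}^k\partial_{x^k}$ (summing over $k$). A Type $\mathcal{A}$ model is a pair $(\mathbb{R}^2,\nabla)$ where $\nabla$ is torsion free and its Christoffel symbols $\Gamma_{ij}{}^k=\Gamma_{ji}{}^k$ in the standard coordinates $(x^1,x^2)$ are real constants. A smooth function $g$ provides a strong projective equivalence between $(M,\nabla)$ and $(M,\tilde\nabla)$ if, with $\omega=dg$, $\nabla_XY=\tilde\nabla_XY+\omega(X)Y+\omega(Y)X$ for all vector fields $X,Y$ (replacing $g$ by $-g$ exchanges the roles of $\nabla$ and $\tilde\nabla$). A model is flat if its curvature operator $R(\xi_1,\xi_2)=\nabla_{\xi_1}\nabla_{\xi_2}-\nabla_{\xi_2}\nabla_{\xi_1}-\nabla_{[\xi_1,\xi_2]}$ vanishes identically. *)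

(* Defs.v *)
(* Stdlib world: concrete reals, with Coquelicot for calculus in two variables. *)
From Stdlib Require Import Reals.
From Coquelicot Require Import Coquelicot.
Open Scope R_scope.

(* The two coordinate indices of R^2. *)
Inductive idx : Set := i1 | i2.

Definition scalar_field : Type := R -> R -> R.

(* [X k] is the coefficient of the k-th coordinate field: X = X^k d_{x^k}. *)
Definition vector_field : Type := idx -> scalar_field.

(* C^infinity: [ex_diff_n f n] says that all iterated partial derivatives of
   order at most n exist and are continuous. *)
Definition smooth (f : scalar_field) : Prop :=
  forall (n : nat) (x y : R), ex_diff_n f n x y.

Definition smooth_vf (X : vector_field) : Prop := forall k : idx, smooth (X k).

Definition sf_mult (f g : scalar_field) : scalar_field :=
  fun x y => f x y * g x y.

Definition vf_zero : vector_field := fun _ _ _ => 0.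

Definition vf_plus (X Y : vector_field) : vector_field :=
  fun k x y => X k x y + Y k x y.

Definition vf_minus (X Y : vector_field) : vector_field :=
  fun k x y => X k x y - Y k x y.

Definition vf_scal (f : scalar_field) (X : vector_field) : vector_field :=
  fun k => sf_mult f (X k).

Definition partial (i : idx) (f : scalar_field) : scalar_field :=
  match i with
  | i1 => fun x y => Derive (fun t => f t y) x
  | i2 => fun x y => Derive (fun t => f x t) y
  end.

Definition coord_vf (i : idx) : vector_field :=
  fun j _ _ => match i, j with
               | i1, i1 | i2, i2 => 1
               | _, _ => 0
               end.

(* X(f) = df(X). *)
Definition dir_deriv (X : vector_field) (f : scalar_field) : scalar_field :=
  fun x y => X i1 x y * partial i1 f x y + X i2 x y * partial i2 f x y.

Definition lie_bracket (X Y : vector_field) : vector_field :=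
  fun k x y => dir_deriv X (Y k) x y - dir_deriv Y (X k) x y.

(* Connections on T(R^2), as operators nabla X Y = nabla_X Y on smooth vector
   fields. The operator is a total function for convenience: its values on
   vector fields that are not smooth are unconstrained, and every notion below
   only involves smooth vector fields. *)
Definition operator : Type := vector_field -> vector_field -> vector_field.

Record is_connection (nabla : operator) : Prop := {
  conn_smooth : forall X Y : vector_field,
    smooth_vf X -> smooth_vf Y -> smooth_vf (nabla X Y);
  conn_plus_l : forall X1 X2 Y : vector_field,
    smooth_vf X1 -> smooth_vf X2 -> smooth_vf Y ->
    nabla (vf_plus X1 X2) Y = vf_plus (nabla X1 Y) (nabla X2 Y);
  conn_scal_l : forall (f : scalar_field) (X Y : vector_field),
    smooth f -> smooth_vf X -> smooth_vf Y ->
    nabla (vf_scal f X) Y = vf_scal f (nabla X Y);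
  conn_plus_r : forall X Y1 Y2 : vector_field,
    smooth_vf X -> smooth_vf Y1 -> smooth_vf Y2 ->
    nabla X (vf_plus Y1 Y2) = vf_plus (nabla X Y1) (nabla X Y2);
  conn_leibniz : forall (f : scalar_field) (X Y : vector_field),
    smooth f -> smooth_vf X -> smooth_vf Y ->
    nabla X (vf_scal f Y) =
      vf_plus (vf_scal (dir_deriv X f) Y) (vf_scal f (nabla X Y))
}.

Definition torsion_free (nabla : operator) : Prop :=
  forall X Y : vector_field, smooth_vf X -> smooth_vf Y ->
    vf_minus (nabla X Y) (nabla Y X) = lie_bracket X Y.

(* Gamma_ij^k, the coefficient of d_{x^k} in nabla_{d_{x^i}} d_{x^j}. *)
Definition christoffel (nabla : operator) (i j k : idx) : scalar_field :=
  nabla (coord_vf i) (coord_vf j) k.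

(* The symmetry Gamma_ij^k = Gamma_ji^k is not listed: it is the torsion-free
   condition for the coordinate frame. *)
Record is_type_A_model (nabla : operator) : Prop := {
  type_A_connection : is_connection nabla;
  type_A_torsion_free : torsion_free nabla;
  type_A_constant : exists Gamma : idx -> idx -> idx -> R,
    forall (i j k : idx) (x y : R), christoffel nabla i j k x y = Gamma i j k
}.

Definition curvature (nabla : operator) (X Y Z : vector_field) : vector_field :=
  vf_minus (vf_minus (nabla X (nabla Y Z)) (nabla Y (nabla X Z)))
           (nabla (lie_bracket X Y) Z).

Definition is_flat (nabla : operator) : Prop :=
  forall X Y Z : vector_field, smooth_vf X -> smooth_vf Y -> smooth_vf Z ->
    curvature nabla X Y Z = vf_zero.

(* nabla_X Y = nabla'_X Y + omega(X) Y + omega(Y) X, where omega = dg. *)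
Definition strong_proj_equiv (g : scalar_field) (nabla nabla' : operator) : Prop :=
  smooth g /\
  forall X Y : vector_field, smooth_vf X -> smooth_vf Y ->
    nabla X Y =
      vf_plus (nabla' X Y)
        (vf_plus (vf_scal (dir_deriv X g) Y) (vf_scal (dir_deriv Y g) X)).

(* Main.v *)
Require Import Defs.
From Stdlib Require Import Reals.
From Coquelicot Require Import Coquelicot.
From Stdlib Require Import Lra FunctionalExtensionality.
Open Scope R_scope.

(** For constant Christoffel symbols the curvature is the commutator of the two
    matrices [Gamma_1], [Gamma_2].  Subtracting [a_i delta_j^k + a_j delta_i^k]
    from [Gamma] and writing [u = Gamma_12^2 - a_1], [v = Gamma_12^1 - a_2], the
    vanishing of this commutator becomes a system of three quadratic equations
    in [u] and [v].  If [Gamma_11^2] or [Gamma_22^1] is nonzero, one unknown can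
    be eliminated and the system reduces to a single real cubic, which has a
    root; if both vanish, [u = v = 0] is a solution. *)

(** * Smooth functions on the plane: derivative rules and closure properties *)

Definition sf_const (c : R) : scalar_field := fun _ _ => c.

Definition sf_plus (f g : scalar_field) : scalar_field :=
  fun x y => f x y + g x y.

Lemma sf_ext (f g : scalar_field) : (forall x y, f x y = g x y) -> f = g.
Proof.
  intros H; extensionality x; extensionality y; apply H.
Qed.

Lemma vf_ext (X Y : vector_field) : (forall k x y, X k x y = Y k x y) -> X = Y.
Proof.
  intros H; extensionality k; apply sf_ext, H.
Qed.

Definition partially_derivable (f : scalar_field) : Prop :=
  forall x y, ex_derive (fun t => f t y) x /\ ex_derive (fun t => f x t) y.

Lemma partial_const (i : idx) (c : R) : partial i (sf_const c) = sf_const 0.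
Proof.
  apply sf_ext; intros x y; destruct i; apply (Derive_const c).
Qed.

Lemma partial_plus (i : idx) (f g : scalar_field) :
  partially_derivable f -> partially_derivable g ->
  partial i (sf_plus f g) = sf_plus (partial i f) (partial i g).
Proof.
  intros Hf Hg; apply sf_ext; intros x y.
  destruct (Hf x y), (Hg x y); destruct i.
  - apply (Derive_plus (fun t => f t y) (fun t => g t y)); assumption.
  - apply (Derive_plus (fun t => f x t) (fun t => g x t)); assumption.
Qed.

Lemma partial_mult (i : idx) (f g : scalar_field) :
  partially_derivable f -> partially_derivable g ->
  partial i (sf_mult f g)
  = sf_plus (sf_mult (partial i f) g) (sf_mult f (partial i g)).
Proof.
  intros Hf Hg; apply sf_ext; intros x y.
  destruct (Hf x y), (Hg x y); destruct i.
  - apply (Derive_mult (fun t => f t y) (fun t => g t y)); assumption.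
  - apply (Derive_mult (fun t => f x t) (fun t => g x t)); assumption.
Qed.

(** Fixing the order and quantifying over all points turns the pointwise recursion of [ex_diff_n]
    into a recursion on functions: [Cn (S n)] refers to [Cn n] of the partials. The closure proofs
    are inductions on this order. *)
Definition Cn (n : nat) (f : scalar_field) : Prop :=
  forall x y, ex_diff_n f n x y.

Lemma Cn_continuous (n : nat) (f : scalar_field) :
  Cn n f -> forall x y, continuity_2d_pt f x y.
Proof.
  intros H x y; specialize (H x y); destruct n; apply H.
Qed.

Lemma Cn_succ (n : nat) (f : scalar_field) :
  Cn (S n) f <->
  (forall x y, continuity_2d_pt f x y) /\ partially_derivable f /\
  forall i, Cn n (partial i f).
Proof.
  split.
  - intros H; repeat split.
    + apply (Cn_continuous _ _ H).
    + apply (H x y).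
    + apply (H x y).
    + intros i x y; destruct i; apply (H x y).
  - intros [Hc [Hd Hp]] x y.
    exact (conj (Hc x y) (conj (proj1 (Hd x y)) (conj (proj2 (Hd x y))
      (conj (Hp i1 x y) (Hp i2 x y))))).
Qed.

Lemma Cn_pred (n : nat) (f : scalar_field) : Cn (S n) f -> Cn n f.
Proof.
  intros H x y; apply (ex_diff_n_m (S n)); [auto with arith | apply H].
Qed.

Lemma Cn_const (n : nat) (c : R) : Cn n (sf_const c).
Proof.
  revert c; induction n as [|n IH]; intros c.
  - intros x y; split; [apply continuity_2d_pt_const | exact I].
  - apply Cn_succ; split; [|split].
    + intros x y; apply continuity_2d_pt_const.
    + intros x y; split; apply (ex_derive_const c).
    + intros i; rewrite partial_const; apply IH.
Qed.

Lemma Cn_plus (n : nat) (f g : scalar_field) :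
  Cn n f -> Cn n g -> Cn n (sf_plus f g).
Proof.
  revert f g; induction n as [|n IH]; intros f g Hf Hg.
  - intros x y; split; [|exact I].
    apply continuity_2d_pt_plus; [apply Hf | apply Hg].
  - apply Cn_succ in Hf as [Hf [Df Pf]], Hg as [Hg [Dg Pg]].
    apply Cn_succ; split; [|split].
    + intros x y; apply continuity_2d_pt_plus; auto.
    + intros x y; destruct (Df x y), (Dg x y); split.
      * apply (ex_derive_plus (fun t => f t y) (fun t => g t y)); assumption.
      * apply (ex_derive_plus (fun t => f x t) (fun t => g x t)); assumption.
    + intros i; rewrite partial_plus; auto.
Qed.

Lemma Cn_mult (n : nat) (f g : scalar_field) :
  Cn n f -> Cn n g -> Cn n (sf_mult f g).
Proof.
  revert f g; induction n as [|n IH]; intros f g Hf Hg.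
  - intros x y; split; [|exact I].
    apply continuity_2d_pt_mult; [apply Hf | apply Hg].
  (* The product rule leaves one factor undifferentiated in each summand, so [f] and [g] themselves
     are also needed at order [n]. *)
  - pose proof (Cn_pred _ _ Hf); pose proof (Cn_pred _ _ Hg).
    apply Cn_succ in Hf as [Hf [Df Pf]], Hg as [Hg [Dg Pg]].
    apply Cn_succ; split; [|split].
    + intros x y; apply continuity_2d_pt_mult; auto.
    + intros x y; destruct (Df x y), (Dg x y); split.
      * apply (ex_derive_mult (fun t => f t y) (fun t => g t y)); assumption.
      * apply (ex_derive_mult (fun t => f x t) (fun t => g x t)); assumption.
    + intros i; rewrite partial_mult by assumption; apply Cn_plus; auto.
Qed.

Lemma smooth_const (c : R) : smooth (sf_const c).
Proof.
  intros n; exact (Cn_const n c).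
Qed.

Lemma smooth_plus (f g : scalar_field) :
  smooth f -> smooth g -> smooth (sf_plus f g).
Proof.
  intros Hf Hg n; exact (Cn_plus n f g (Hf n) (Hg n)).
Qed.

Lemma smooth_mult (f g : scalar_field) :
  smooth f -> smooth g -> smooth (sf_mult f g).
Proof.
  intros Hf Hg n; exact (Cn_mult n f g (Hf n) (Hg n)).
Qed.

Lemma smooth_partial (i : idx) (f : scalar_field) :
  smooth f -> smooth (partial i f).
Proof.
  intros Hf n; exact (proj2 (proj2 (proj1 (Cn_succ n f) (Hf (S n)))) i).
Qed.

Lemma smooth_derivable (f : scalar_field) : smooth f -> partially_derivable f.
Proof.
  intros Hf; exact (proj1 (proj2 (proj1 (Cn_succ 0 f) (Hf 1%nat)))).
Qed.

Lemma smooth_dir_deriv (X : vector_field) (f : scalar_field) :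
  smooth_vf X -> smooth f -> smooth (dir_deriv X f).
Proof.
  intros HX Hf.
  apply (smooth_plus (sf_mult (X i1) (partial i1 f))
                     (sf_mult (X i2) (partial i2 f)));
    apply smooth_mult; auto using smooth_partial.
Qed.

(** * Coordinate functions, mixed partials and directional derivatives *)

Definition coord (i : idx) : scalar_field :=
  fun x y => match i with i1 => x | i2 => y end.

Lemma partial_coord (i j : idx) : partial i (coord j) = coord_vf i j.
Proof.
  apply sf_ext; intros x y; destruct i, j; cbn;
    solve [apply Derive_id | apply Derive_const].
Qed.

Lemma smooth_coord_vf (i : idx) : smooth_vf (coord_vf i).
Proof.
  intros k; destruct i, k; apply smooth_const.
Qed.

Lemma smooth_coord (i : idx) : smooth (coord i).
Proof.
  assert (H : forall n, Cn (S n) (coord i)).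
  { intros n; apply Cn_succ; split; [|split].
    - intros x y; destruct i;
        [apply continuity_2d_pt_id1 | apply continuity_2d_pt_id2].
    - intros x y; destruct i; split;
        [exact (ex_derive_id x) | exact (ex_derive_const x y)
        | exact (ex_derive_const y x) | exact (ex_derive_id y)].
    - intros j; rewrite partial_coord; exact (smooth_coord_vf j i n). }
  intros n; apply Cn_pred, H.
Qed.

Lemma partial_comm (f : scalar_field) :
  smooth f -> partial i1 (partial i2 f) = partial i2 (partial i1 f).
Proof.
  intros Hf; apply sf_ext; intros x y; apply Schwarz.
  - apply locally_2d_forall; intros u v.
    pose proof (smooth_derivable _ Hf u v).
    pose proof (smooth_derivable _ (smooth_partial i1 _ Hf) u v).
    pose proof (smooth_derivable _ (smooth_partial i2 _ Hf) u v).
    tauto.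
  (* Order zero of [ex_diff_n] is exactly the continuity of the mixed partial that [Schwarz] asks
     for. *)
  - apply (smooth_partial i1 _ (smooth_partial i2 _ Hf) 0%nat).
  - apply (smooth_partial i2 _ (smooth_partial i1 _ Hf) 0%nat).
Qed.

Lemma dir_deriv_plus (X : vector_field) (f g : scalar_field) :
  smooth f -> smooth g ->
  dir_deriv X (sf_plus f g) = sf_plus (dir_deriv X f) (dir_deriv X g).
Proof.
  intros Hf Hg; apply sf_ext; intros x y; unfold dir_deriv.
  rewrite !partial_plus by auto using smooth_derivable; unfold sf_plus; ring.
Qed.

Lemma dir_deriv_mult (X : vector_field) (f g : scalar_field) :
  smooth f -> smooth g ->
  dir_deriv X (sf_mult f g)
  = sf_plus (sf_mult (dir_deriv X f) g) (sf_mult f (dir_deriv X g)).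
Proof.
  intros Hf Hg; apply sf_ext; intros x y; unfold dir_deriv.
  rewrite !partial_mult by auto using smooth_derivable.
  unfold sf_plus, sf_mult; ring.
Qed.

Lemma dir_deriv_const (X : vector_field) (c : R) :
  dir_deriv X (sf_const c) = sf_const 0.
Proof.
  apply sf_ext; intros x y; unfold dir_deriv; rewrite !partial_const.
  unfold sf_const; ring.
Qed.

(** * Connections with constant Christoffel symbols *)

Definition symbols : Type := idx -> idx -> idx -> R.

Definition gamma_term (G : symbols) (X Y : vector_field) (k i j : idx) :
  scalar_field := sf_mult (sf_const (G i j k)) (sf_mult (X i) (Y j)).

(** Built from [sf_plus] and [sf_mult] rather than from pointwise sums, so that the smoothness
    lemmas and derivative rules apply to it directly. *)
Definition const_conn (G : symbols) : operator := fun X Y k =>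
  sf_plus (dir_deriv X (Y k))
    (sf_plus (sf_plus (gamma_term G X Y k i1 i1) (gamma_term G X Y k i1 i2))
             (sf_plus (gamma_term G X Y k i2 i1) (gamma_term G X Y k i2 i2))).

Lemma const_conn_val (G : symbols) (X Y : vector_field) (k : idx) (x y : R) :
  const_conn G X Y k x y =
  dir_deriv X (Y k) x y
  + (G i1 i1 k * (X i1 x y * Y i1 x y) + G i1 i2 k * (X i1 x y * Y i2 x y)
     + (G i2 i1 k * (X i2 x y * Y i1 x y) + G i2 i2 k * (X i2 x y * Y i2 x y))).
Proof.
  reflexivity.
Qed.

Lemma smooth_gamma_term (G : symbols) (X Y : vector_field) (k i j : idx) :
  smooth_vf X -> smooth_vf Y -> smooth (gamma_term G X Y k i j).
Proof.
  intros HX HY; unfold gamma_term; auto using smooth_mult, smooth_const.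
Qed.

Lemma dir_deriv_gamma_term (G : symbols) (W X Y : vector_field) (k i j : idx)
    (x y : R) :
  smooth_vf X -> smooth_vf Y ->
  dir_deriv W (gamma_term G X Y k i j) x y =
  G i j k * (dir_deriv W (X i) x y * Y j x y + X i x y * dir_deriv W (Y j) x y).
Proof.
  intros HX HY; unfold gamma_term.
  rewrite dir_deriv_mult, dir_deriv_const, dir_deriv_mult
    by auto using smooth_mult, smooth_const.
  unfold sf_plus, sf_mult, sf_const; ring.
Qed.

Lemma smooth_const_conn (G : symbols) (X Y : vector_field) :
  smooth_vf X -> smooth_vf Y -> smooth_vf (const_conn G X Y).
Proof.
  intros HX HY k; unfold const_conn.
  auto 6 using smooth_plus, smooth_dir_deriv, smooth_gamma_term.
Qed.

Lemma const_conn_is_connection (G : symbols) : is_connection (const_conn G).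
Proof.
  split.
  - apply smooth_const_conn.
  - intros; apply vf_ext; intros k x y; unfold vf_plus at 2.
    rewrite !const_conn_val; unfold vf_plus, dir_deriv; ring.
  - intros; apply vf_ext; intros k x y; unfold vf_scal at 2, sf_mult at 1.
    rewrite !const_conn_val; unfold vf_scal, sf_mult, dir_deriv; ring.
  - intros X Y1 Y2 HX H1 H2; apply vf_ext; intros k x y; unfold vf_plus at 2.
    rewrite !const_conn_val.
    change (vf_plus Y1 Y2 k) with (sf_plus (Y1 k) (Y2 k)).
    rewrite dir_deriv_plus by auto; unfold vf_plus, sf_plus; ring.
  - intros f X Y Hf HX HY; apply vf_ext; intros k x y.
    unfold vf_plus, vf_scal at 2 3, sf_mult.
    rewrite !const_conn_val; unfold vf_scal at 1.
    rewrite dir_deriv_mult by auto.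
    unfold vf_scal, sf_plus, sf_mult; ring.
Qed.

Lemma const_conn_type_A (G : symbols) :
  (forall i j k, G i j k = G j i k) -> is_type_A_model (const_conn G).
Proof.
  intros HG; split.
  - apply const_conn_is_connection.
  - intros X Y _ _; apply vf_ext; intros k x y; unfold vf_minus.
    rewrite !const_conn_val, (HG i2 i1 k); unfold lie_bracket; ring.
  - exists G; intros i j k x y; unfold christoffel; rewrite const_conn_val.
    replace (dir_deriv (coord_vf i) (coord_vf j k)) with (sf_const 0)
      by (destruct j, k; symmetry; apply dir_deriv_const).
    destruct i, j; unfold sf_const; cbn; ring.
Qed.

Lemma vf_coord_decomposition (X : vector_field) :
  X = vf_plus (vf_scal (X i1) (coord_vf i1)) (vf_scal (X i2) (coord_vf i2)).
Proof.
  apply vf_ext; intros k x y; unfold vf_plus, vf_scal, sf_mult.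
  destruct k; cbn; ring.
Qed.

(** Additivity and the Leibniz rule in [Y], then linearity over functions in [X], reduce the
    operator to its values on pairs of coordinate fields. This replaces an abstract connection by an
    explicit formula on smooth fields. *)
Lemma connection_const_christoffel (nabla : operator) (G : symbols)
    (X Y : vector_field) :
  is_connection nabla ->
  (forall i j k x y, christoffel nabla i j k x y = G i j k) ->
  smooth_vf X -> smooth_vf Y -> nabla X Y = const_conn G X Y.
Proof.
  intros [_ Hpl Hsl Hpr Hl] HG HX HY.
  assert (Hs : forall f Z, smooth f -> smooth_vf Z -> smooth_vf (vf_scal f Z))
    by (intros f Z Hf HZ k; apply smooth_mult; auto).
  apply vf_ext; intros k x y.
  rewrite (vf_coord_decomposition Y) at 1.
  rewrite Hpr, !Hl by auto using smooth_coord_vf.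
  (* Occurrences 2 and 4 are the first arguments of [nabla]; those inside [dir_deriv] already have
     the form found on the right-hand side. *)
  rewrite (vf_coord_decomposition X) at 2 4.
  rewrite !Hpl, !Hsl by auto using smooth_coord_vf.
  rewrite const_conn_val; unfold vf_plus, vf_scal, sf_mult.
  pose proof (fun i j => HG i j k x y) as Hk; unfold christoffel in Hk.
  rewrite !Hk; destruct k; cbn; ring.
Qed.

(** * Curvature of a connection with constant symbols *)

Lemma dir_deriv_const_conn (G : symbols) (W X Y : vector_field) (k : idx)
    (x y : R) :
  smooth_vf X -> smooth_vf Y ->
  dir_deriv W (const_conn G X Y k) x y =
  dir_deriv W (dir_deriv X (Y k)) x y
  + (const_conn G (fun i => dir_deriv W (X i)) Y k x y
     - dir_deriv (fun i => dir_deriv W (X i)) (Y k) x y)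
  + (const_conn G X (fun i => dir_deriv W (Y i)) k x y
     - dir_deriv X (dir_deriv W (Y k)) x y).
Proof.
  (* As the symbols are constant, [W] differentiates only the components: [Gamma(X, Y)] yields
     [Gamma(WX, Y) + Gamma(X, WY)]. Each of these is expressed as a value of [const_conn] minus its
     derivative part. *)
  intros HX HY; unfold const_conn at 1.
  rewrite !dir_deriv_plus
    by auto 6 using smooth_plus, smooth_dir_deriv, smooth_gamma_term.
  unfold sf_plus; rewrite !dir_deriv_gamma_term, !const_conn_val by assumption.
  ring.
Qed.

(** Separates the first-order part from the second-order part. The latter is symmetric in [X] and
    [Y] once mixed partials commute, so it drops out of the commutator. *)
Lemma dir_deriv_dir_deriv (X Y : vector_field) (f : scalar_field) (x y : R) :
  smooth_vf Y -> smooth f ->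
  dir_deriv X (dir_deriv Y f) x y =
  dir_deriv (fun i => dir_deriv X (Y i)) f x y
  + (Y i1 x y * dir_deriv X (partial i1 f) x y
     + Y i2 x y * dir_deriv X (partial i2 f) x y).
Proof.
  intros HY Hf.
  change (dir_deriv Y f) with
    (sf_plus (sf_mult (Y i1) (partial i1 f)) (sf_mult (Y i2) (partial i2 f))).
  rewrite dir_deriv_plus, !dir_deriv_mult
    by auto using smooth_mult, smooth_partial.
  unfold sf_plus, sf_mult, dir_deriv at 5; ring.
Qed.

Lemma dir_deriv_commutator (X Y : vector_field) (f : scalar_field) (x y : R) :
  smooth_vf X -> smooth_vf Y -> smooth f ->
  dir_deriv X (dir_deriv Y f) x y - dir_deriv Y (dir_deriv X f) x y
  = dir_deriv (lie_bracket X Y) f x y.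
Proof.
  intros HX HY Hf; rewrite !dir_deriv_dir_deriv by assumption.
  unfold lie_bracket, dir_deriv; rewrite (partial_comm f Hf); ring.
Qed.

(* The commutator of the endomorphisms [Gamma_1] and [Gamma_2], where
   [Gamma_i] sends [d_l] to [Gamma_il^k d_k]. *)
Definition const_curvature (G : symbols) (l k : idx) : R :=
  G i1 i1 k * G i2 l i1 + G i1 i2 k * G i2 l i2
  - (G i2 i1 k * G i1 l i1 + G i2 i2 k * G i1 l i2).

(** Antisymmetrising in [X] and [Y] cancels the terms [Gamma(X, YZ)] and [Gamma(Y, XZ)], and the
    remaining derivative terms add up to the covariant derivative along the bracket. Only the part
    quadratic in the symbols survives. *)
Lemma curvature_const_conn (G : symbols) (X Y Z : vector_field) (k : idx)
    (x y : R) :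
  smooth_vf X -> smooth_vf Y -> smooth_vf Z ->
  curvature (const_conn G) X Y Z k x y =
  (X i1 x y * Y i2 x y - X i2 x y * Y i1 x y)
  * (const_curvature G i1 k * Z i1 x y + const_curvature G i2 k * Z i2 x y).
Proof.
  intros HX HY HZ; unfold curvature, vf_minus.
  rewrite (const_conn_val G X (const_conn G Y Z)),
    (const_conn_val G Y (const_conn G X Z)),
    (dir_deriv_const_conn G X Y), (dir_deriv_const_conn G Y X) by assumption.
  rewrite !const_conn_val, <- (dir_deriv_commutator X Y (Z k)) by auto.
  cbv beta; unfold lie_bracket, const_curvature; ring.
Qed.

Lemma const_conn_flat (G : symbols) :
  (forall l k, const_curvature G l k = 0) -> is_flat (const_conn G).
Proof.
  intros HG X Y Z HX HY HZ; apply vf_ext; intros k x y.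
  rewrite curvature_const_conn, !HG by assumption; unfold vf_zero; ring.
Qed.

(** * Real solutions of the quadratic flatness system *)

Lemma cubic_root (p q r : R) : exists u : R, u ^ 3 + p * u ^ 2 + q * u + r = 0.
Proof.
  set (f := fun u : R => u ^ 3 + p * u ^ 2 + q * u + r).
  (* At radius [1 + S] the cubic term dominates, so [f] is nonnegative at [1 + S] and nonpositive at
     [- (1 + S)]. *)
  set (S := Rabs p + Rabs q + Rabs r).
  assert (HS : 0 <= S)
    by (unfold S; pose proof (Rabs_pos p); pose proof (Rabs_pos q);
        pose proof (Rabs_pos r); lra).
  assert (Hbound : forall m, 1 <= m -> m - 1 = S ->
    0 <= f m /\ f (- m) <= 0).
  { intros m Hm HmS.
    assert (Hp : - (Rabs p * m ^ 2) <= p * m ^ 2 <= Rabs p * m ^ 2)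
      by (unfold Rabs; destruct (Rcase_abs p); nra).
    assert (Hq : Rabs q * m <= Rabs q * m ^ 2)
      by (apply Rmult_le_compat_l; [apply Rabs_pos | nra]).
    assert (Hq' : - (Rabs q * m) <= q * m <= Rabs q * m)
      by (unfold Rabs; destruct (Rcase_abs q); nra).
    assert (Hr : Rabs r <= Rabs r * m ^ 2)
      by (rewrite <- (Rmult_1_r (Rabs r)) at 1;
          apply Rmult_le_compat_l; [apply Rabs_pos | nra]).
    assert (Hr' : - Rabs r <= r <= Rabs r)
      by (unfold Rabs; destruct (Rcase_abs r); lra).
    (* Writing one factor [m] as [1 + S] gives the cube a share of [m ^ 2] for each coefficient,
       enough to absorb every lower term. *)
    assert (Hm3 : m ^ 3 = m ^ 2 + Rabs p * m ^ 2 + Rabs q * m ^ 2 + Rabs r * m ^ 2)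
      by (replace (m ^ 3) with (m ^ 2 * (1 + (m - 1))) by ring;
          rewrite HmS; unfold S; ring).
    assert (0 <= m ^ 2) by nra.
    unfold f; split; [lra|].
    replace ((- m) ^ 3 + p * (- m) ^ 2 + q * - m + r)
      with (- m ^ 3 + p * m ^ 2 - q * m + r) by ring; lra. }
  destruct (Hbound (1 + S)) as [H1 H2]; [lra | ring |].
  destruct (IVT_cor f (- (1 + S)) (1 + S)) as [u [_ Hu]].
  - unfold f; reg.
  - lra.
  - nra.
  - exists u; exact Hu.
Qed.

Lemma eliminated_system (B E P Q : R) : B <> 0 ->
  exists u v : R,
    u * v = B * E /\ u * (P + u) = B * (Q - v) /\ E * (P + u) = v * (Q - v).
Proof.
  intros HB.
  (* Solving the second equation for [v] gives [v = Q - u * (P + u) / B]; inserting this in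
     [u * v = B * E] and clearing [B] gives this cubic in [u]. *)
  destruct (cubic_root P (- (B * Q)) (B * B * E)) as [u Hu].
  set (v := Q - u * (P + u) / B).
  assert (Hv : u * (P + u) = B * (Q - v)) by (unfold v; field; assumption).
  assert (Huv : u * v = B * E).
  { apply (Rmult_eq_reg_l B); [|assumption].
    replace (B * (u * v)) with (u * (B * Q - B * (Q - v))) by ring.
    rewrite <- Hv; lra. }
  exists u, v; repeat split; try assumption.
  (* Multiplied by [B], the third equation follows from the other two: both sides equal
     [u * v * (P + u)]. *)
  apply (Rmult_eq_reg_l B); [|assumption].
  replace (B * (E * (P + u))) with (B * E * (P + u)) by ring.
  rewrite <- Huv; replace (B * (v * (Q - v))) with (B * (Q - v) * v) by ring.
  rewrite <- Hv; ring.
Qed.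

Lemma flatness_system (B E P Q : R) :
  exists u v : R,
    u * v = B * E /\ u * (P + u) = B * (Q - v) /\ E * (P + u) = v * (Q - v).
Proof.
  destruct (Req_dec B 0) as [-> | HB]; [|apply eliminated_system; assumption].
  destruct (Req_dec E 0) as [-> | HE].
  - exists 0, 0; repeat split; ring.
  - (* Exchanging [(B, P, u)] and [(E, -Q, v)] preserves the system. *)
    destruct (eliminated_system E 0 (- Q) (- P) HE) as [v [u [H1 [H2 H3]]]].
    exists u, v; repeat split; lra.
Qed.

(** * Making the symbols flat by a projective shift *)

Definition kronecker (j k : idx) : R := coord_vf j k 0 0.

(** These are the symbols of the target connection when [omega] has constant components [a i]. *)
Definition shifted_symbols (G : symbols) (a : idx -> R) : symbols :=
  fun i j k => G i j k - (a i * kronecker j k + a j * kronecker i k).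

(** The shift turns the symbols [12^2], [12^1], [11^1], [22^2] into [u], [v], [P + 2 * u],
    [2 * v - Q] and leaves [B] (index [11^2]) and [E] (index [22^1]) alone. A commutator has trace
    zero, so its two diagonal entries both give [u * v = B * E] and only three equations remain. *)
Lemma flat_shift (G : symbols) : (forall i j k, G i j k = G j i k) ->
  exists a : idx -> R, forall l k, const_curvature (shifted_symbols G a) l k = 0.
Proof.
  intros HG.
  destruct (flatness_system (G i1 i1 i2) (G i2 i2 i1)
    (G i1 i1 i1 - 2 * G i1 i2 i2) (2 * G i1 i2 i1 - G i2 i2 i2))
    as [u [v [H1 [H2 H3]]]].
  exists (fun i => match i with i1 => G i1 i2 i2 - u | i2 => G i1 i2 i1 - v end).
  intros l k; destruct l, k;
    unfold const_curvature, shifted_symbols, kronecker; cbn;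
    rewrite ?(HG i2 i1); lra.
Qed.

(** * Linear potentials and the projective equivalence *)

Definition linear_sf (a1 a2 : R) : scalar_field := fun x y => a1 * x + a2 * y.

Lemma linear_sf_coord (a1 a2 : R) :
  linear_sf a1 a2 = sf_plus (sf_mult (sf_const a1) (coord i1))
                            (sf_mult (sf_const a2) (coord i2)).
Proof.
  reflexivity.
Qed.

Lemma smooth_linear_sf (a1 a2 : R) : smooth (linear_sf a1 a2).
Proof.
  rewrite linear_sf_coord.
  auto using smooth_plus, smooth_mult, smooth_const, smooth_coord.
Qed.

Lemma dir_deriv_linear_sf (X : vector_field) (a1 a2 x y : R) :
  dir_deriv X (linear_sf a1 a2) x y = a1 * X i1 x y + a2 * X i2 x y.
Proof.
  rewrite linear_sf_coord.
  rewrite dir_deriv_plus, !dir_deriv_mult, !dir_deriv_const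
    by auto using smooth_mult, smooth_const, smooth_coord.
  unfold sf_plus, sf_mult, sf_const, dir_deriv; rewrite !partial_coord; cbn; ring.
Qed.

(** Coordinate fields have constant components, so their bracket vanishes and torsion-freeness
    equates the two covariant derivatives. *)
Lemma type_A_symbols_symmetric (nabla : operator) (G : symbols) :
  torsion_free nabla ->
  (forall i j k x y, christoffel nabla i j k x y = G i j k) ->
  forall i j k, G i j k = G j i k.
Proof.
  intros HT HG i j k.
  pose proof (HT _ _ (smooth_coord_vf i) (smooth_coord_vf j)) as H.
  apply (f_equal (fun Z : vector_field => Z k 0 0)) in H.
  unfold vf_minus, lie_bracket in H.
  replace (dir_deriv (coord_vf i) (coord_vf j k)) with (sf_const 0) in H
    by (destruct j, k; symmetry; apply dir_deriv_const).
  replace (dir_deriv (coord_vf j) (coord_vf i k)) with (sf_const 0) in H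
    by (destruct i, k; symmetry; apply dir_deriv_const).
  pose proof (HG i j k 0 0) as H1; pose proof (HG j i k 0 0) as H2.
  unfold christoffel in H1, H2; unfold sf_const in H; lra.
Qed.

Theorem lemma2p1 (nabla : operator) (hM : is_type_A_model nabla) :
  exists a1 a2 : R, exists nabla' : operator,
    is_type_A_model nabla' /\ is_flat nabla' /\
    strong_proj_equiv (fun x1 x2 : R => a1 * x1 + a2 * x2) nabla nabla'.
Proof.
  destruct hM as [HC HT [G HG]].
  pose proof (type_A_symbols_symmetric nabla G HT HG) as Hsym.
  destruct (flat_shift G Hsym) as [a Ha].
  exists (a i1), (a i2), (const_conn (shifted_symbols G a)).
  split; [|split; [|split]].
  - apply const_conn_type_A; intros i j k; unfold shifted_symbols.
    rewrite (Hsym i j k); ring.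
  - apply const_conn_flat, Ha.
  - apply (smooth_linear_sf (a i1) (a i2)).
  - intros X Y HX HY.
    (* With [nabla] in explicit form, both connections share the same derivative part; the
       difference of their symbols is exactly the contribution of [dg]. *)
    rewrite (connection_const_christoffel nabla G) by assumption.
    apply vf_ext; intros k x y; unfold vf_plus, vf_scal, sf_mult.
    pose proof (fun Z => dir_deriv_linear_sf Z (a i1) (a i2) x y) as Hd.
    unfold linear_sf in Hd.
    rewrite !Hd, !const_conn_val.
    unfold shifted_symbols, kronecker; destruct k; cbn; ring.
Qed.
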